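(* For any derivation of a sequent $S \mid \Gamma \vdash C$ in the skew monoidal sequent calculus, there is a derivation $\llbracket S \mid \Gamma \rrbracket \Rightarrow C$ in the skew monoidal categorical calculus. In particular, for any derivation of $A \mid\ \vdash C$ there is a derivation $A \Rightarrow C$.
   Context: Fix a set $\mathrm{Var}$ of atoms. Formulae are generated by: every atom $X \in \mathrm{Var}$ is a formula; $\mathsf{I}$ is a formula; if $A, B$ are formulae then so is $A \otimes B$. A context $\Gamma$ is a finite list of formulae; a stoup $S$ is either empty (written $-$) or a single formula. The skew monoidal categorical calculus derives judgements $A \Rightarrow C$ by the rules: $\mathrm{id}_A : A \Rightarrow A$; from $f : A \Rightarrow B$ and $g : B \Rightarrow C$ infer $g \circ f : A \Rightarrow C$; from $f : A \Rightarrow C$ and $g : B \Rightarrow D$ infer $f \otimes g : A \otimes B \Rightarrow C \otimes D$; axioms $\lambda_A : \mathsf{I} \otimes A \Rightarrow A$, $\rho_A : A \Rightarrow A \otimes \mathsf{I}$, $\alpha_{A,B,C} : (A \otimes B) \otimes C \Rightarrow A \otimes (B \otimes C)$. The skew monoidal sequent calculus derives sequents $S \mid \Gamma \vdash C$ by the rules: (ax) $A \mid\ \vdash A$; (pass) from $A \mid \Gamma \vdash C$ infer $- \mid A, \Gamma \vdash C$; (scut) from $S \mid \Gamma \vdash A$ and $A \mid \Delta \vdash C$ infer $S \mid \Gamma, \Delta \vdash C$; (ccut) from $- \mid \Gamma \vdash A$ and $S \mid \Delta_0, A, \Delta_1 \vdash C$ infer $S \mid \Delta_0, \Gamma, \Delta_1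 \vdash C$; ($\mathsf{I}$L) from $- \mid \Gamma \vdash C$ infer $\mathsf{I} \mid \Gamma \vdash C$; ($\mathsf{I}$R) $- \mid\ \vdash \mathsf{I}$; ($\otimes$L) from $A \mid B, \Gamma \vdash C$ infer $A \otimes B \mid \Gamma \vdash C$; ($\otimes$R) from $S \mid \Gamma \vdash A$ and $- \mid \Delta \vdash B$ infer $S \mid \Gamma, \Delta \vdash A \otimes B$. Interpretation of antecedents: $\llbracket - \rrbracket = \mathsf{I}$, $\llbracket A \rrbracket = A$; $C \triangleleft () = C$, $C \triangleleft (A, \Gamma) = (C \otimes A) \triangleleft \Gamma$; $\llbracket S \mid \Gamma \rrbracket = \llbracket S \rrbracket \triangleleft \Gamma$, i.e. $\llbracket S \mid A_1,\dots,A_n\rrbracket = (\cdots(\llbracket S\rrbracket \otimes A_1)\cdots)\otimes A_n$. *)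

(* Defs.v *)
From Stdlib Require Export List.
Export ListNotations.

Set Implicit Arguments.
Unset Strict Implicit.
Unset Printing Implicit Defensive.

Declare Scope skew_scope.
Delimit Scope skew_scope with skew.

Inductive formula (Var : Type) : Type :=
| Atom (X : Var)
| Unit
| Tensor (A B : formula Var).

Arguments Unit {Var}.
Bind Scope skew_scope with formula.
Notation "A ⊗ B" := (Tensor A B) (at level 40, left associativity) : skew_scope.
Open Scope skew_scope.

Definition context (Var : Type) : Type := list (formula Var).

(* [None] is the empty stoup. *)
Definition stoup (Var : Type) : Type := option (formula Var).

Reserved Notation "A ⇒ C" (at level 70, no associativity).

Inductive cat_deriv (Var : Type) : formula Var -> formula Var -> Type :=
| cat_id A : A ⇒ A
| cat_comp A B C (f : A ⇒ B) (g : B ⇒ C) : A ⇒ C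
| cat_tensor A B C D (f : A ⇒ C) (g : B ⇒ D) : A ⊗ B ⇒ C ⊗ D
| cat_lambda A : Unit ⊗ A ⇒ A
| cat_rho A : A ⇒ A ⊗ Unit
| cat_alpha A B C : (A ⊗ B) ⊗ C ⇒ A ⊗ (B ⊗ C)
where "A ⇒ C" := (cat_deriv A C) : type_scope.

Reserved Notation "S ∣ Γ ⊢ C" (at level 70, Γ at level 69, C at level 69).

Inductive seq_deriv (Var : Type) :
    stoup Var -> context Var -> formula Var -> Type :=
| seq_ax A : Some A ∣ [] ⊢ A
| seq_pass A Γ C (f : Some A ∣ Γ ⊢ C) : None ∣ A :: Γ ⊢ C
| seq_scut S Γ Δ A C (f : S ∣ Γ ⊢ A) (g : Some A ∣ Δ ⊢ C) : S ∣ Γ ++ Δ ⊢ C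
| seq_ccut S Γ Δ0 Δ1 A C (f : None ∣ Γ ⊢ A) (g : S ∣ Δ0 ++ A :: Δ1 ⊢ C) :
    S ∣ Δ0 ++ Γ ++ Δ1 ⊢ C
| seq_IL Γ C (f : None ∣ Γ ⊢ C) : Some Unit ∣ Γ ⊢ C
| seq_IR : None ∣ [] ⊢ Unit
| seq_tensorL A B Γ C (f : Some A ∣ B :: Γ ⊢ C) : Some (A ⊗ B) ∣ Γ ⊢ C
| seq_tensorR S Γ Δ A B (f : S ∣ Γ ⊢ A) (g : None ∣ Δ ⊢ B) :
    S ∣ Γ ++ Δ ⊢ A ⊗ B
where "S ∣ Γ ⊢ C" := (seq_deriv S Γ C) : type_scope.

Definition interp_stoup (Var : Type) (S : stoup Var) : formula Var :=
  match S with
  | None => Unit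
  | Some A => A
  end.

Fixpoint act (Var : Type) (C : formula Var) (Γ : context Var) : formula Var :=
  match Γ with
  | [] => C
  | A :: Γ' => act (C ⊗ A) Γ'
  end.
Notation "C ◁ Γ" := (act C Γ) (at level 45, left associativity) : skew_scope.

Definition interp (Var : Type) (S : stoup Var) (Γ : context Var) : formula Var :=
  interp_stoup S ◁ Γ.
Notation "⟦ S ∣ Γ ⟧" := (interp S Γ) (at level 0, S at level 69, Γ at level 69) : skew_scope.

(* Main.v *)
(** The functor [- ◁ Γ] is lax over the tensor: iterating [cat_alpha] gives
    [(A ⊗ B) ◁ Γ ⇒ A ⊗ (B ◁ Γ)], and precomposing with [cat_rho] gives
    [A ◁ Γ ⇒ A ⊗ (Unit ◁ Γ)], which splits off a part of the context with an
    empty stoup. This interprets [seq_tensorR] and [seq_ccut]; [cat_lambda]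
    interprets [seq_pass], and the other rules need only functoriality. *)

Require Import Defs.

Section Soundness.

Local Set Implicit Arguments.

Variable Var : Type.
Implicit Types (A B C : formula Var) (Γ Δ : context Var) (S : stoup Var).

Lemma act_app C Γ Δ : C ◁ (Γ ++ Δ) = C ◁ Γ ◁ Δ.
Proof. revert C; induction Γ as [|A Γ IH]; intro C; [reflexivity | apply IH]. Qed.

Lemma act_map Γ A B : A ⇒ B -> A ◁ Γ ⇒ B ◁ Γ.
Proof.
  revert A B; induction Γ as [|D Γ IH]; intros A B f; [exact f |].
  exact (IH _ _ (cat_tensor f (cat_id D))).
Qed.

Lemma act_tensor Γ A B : (A ⊗ B) ◁ Γ ⇒ A ⊗ (B ◁ Γ).
Proof.
  (* [A] stays fixed while [B] varies: [cat_alpha] moves the head [D] of the context into the right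
     factor. *)
  revert B; induction Γ as [|D Γ IH]; intro B; [apply cat_id |].
  exact (cat_comp (act_map Γ (cat_alpha A B D)) (IH (B ⊗ D))).
Qed.

Lemma act_split Γ A B : Unit ◁ Γ ⇒ B -> A ◁ Γ ⇒ A ⊗ B.
Proof.
  intro f; apply (cat_comp (act_map Γ (cat_rho A))).
  exact (cat_comp (act_tensor Γ A Unit) (cat_tensor (cat_id A) f)).
Qed.

Lemma soundness S Γ C : S ∣ Γ ⊢ C -> ⟦ S ∣ Γ ⟧ ⇒ C.
Proof.
  unfold interp.
  induction 1 as [A | A Γ C _ f | S Γ Δ A C _ f _ g | S Γ Δ0 Δ1 A C _ f _ g
                 | Γ C _ f | | A B Γ C _ f | S Γ Δ A B _ f _ g].
  - apply cat_id.
  - exact (cat_comp (act_map Γ (cat_lambda A)) f).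
  - rewrite act_app; exact (cat_comp (act_map Δ f) g).
  - rewrite !act_app in *.
    (* [Γ] acts on all that precedes it, [interp_stoup S ◁ Δ0], and is replaced there by the single
       factor [A]. *)
    exact (cat_comp (act_map Δ1 (act_split Γ (interp_stoup S ◁ Δ0) f)) g).
  (* The empty stoup and [Some Unit] have the same interpretation. *)
  - exact f.
  - apply cat_id.
  (* [A ◁ (B :: Γ)] and [(A ⊗ B) ◁ Γ] are convertible. *)
  - exact f.
  - rewrite act_app; exact (cat_comp (act_map Δ f) (act_split Δ A g)).
Qed.

End Soundness.

Theorem theorem3p7 (Var : Type) :
  (forall (S : stoup Var) (Γ : context Var) (C : formula Var),
     S ∣ Γ ⊢ C -> inhabited (⟦ S ∣ Γ ⟧ ⇒ C)) /\
  (forall A C : formula Var, Some A ∣ [] ⊢ C -> inhabited (A ⇒ C)).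
Proof.
  split.
  - intros S Γ C f; exact (inhabits (soundness f)).
  - intros A C f; exact (inhabits (soundness f)).
Qed.
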